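(* Let $n\geqslant 1$. The group $\mathrm{Isom}_e(K_0(\mathbb{P}_n))$ is isomorphic to $\mathbb{Z}^{[\frac{n+1}{2}]}$, where $[x]$ denotes the integer part of $x$.
   Context: $K_0(\mathbb{P}_n)$ is the Grothendieck group of coherent sheaves on the $n$-dimensional projective space $\mathbb{P}_n$ over a fixed ground field; it is a free $\mathbb{Z}$-module of rank $n+1$ with basis the classes of $\mathcal{O},\mathcal{O}(1),\dots,\mathcal{O}(n)$. The Euler form is the (nonsymmetric) nondegenerate bilinear form $\chi(E,F)=\sum_\nu(-1)^\nu\dim\mathrm{Ext}^\nu(E,F)$; it satisfies $\chi(\mathcal{O}(k),\mathcal{O}(m))=\binom{n+m-k}{n}$ for all $k,m\in\mathbb{Z}$, where $\binom{x}{n}=\frac{x(x-1)\cdots(x-n+1)}{n!}$. It is extended $\mathbb{R}$-bilinearly to $K_0(\mathbb{P}_n)\otimes\mathbb{R}$. $\mathrm{Isom}(K_0(\mathbb{P}_n))$ is the group of $\mathbb{Z}$-linear automorphisms of $K_0(\mathbb{P}_n)$ preserving $\chi$; $\mathrm{Isom}(K_0(\mathbb{P}_n)\otimes\mathbb{R})\subset GL(n+1,\mathbb{R})$ is the group of $\mathbb{R}$-linear automorphisms of $K_0(\mathbb{P}_n)\otimes\mathbb{R}$ preserving $\chi$, and $\mathrm{Isom}_e(K_0(\mathbb{P}_n)\otimes\mathbb{R})$ is its connected component of the identity. Regarding $\mathrm{Isom}(K_0(\mathbb{P}_n))$ as a subgroup of $\mathrm{Isom}(K_0(\mathbb{P}_n)\otimes\mathbb{R})$,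 one sets $\mathrm{Isom}_e(K_0(\mathbb{P}_n))=\mathrm{Isom}(K_0(\mathbb{P}_n))\cap \mathrm{Isom}_e(K_0(\mathbb{P}_n)\otimes\mathbb{R})$. *)

(* Defs.v *)
From HB Require Import structures.
From mathcomp Require Import all_boot all_order all_algebra.
From mathcomp Require Import all_classical all_reals all_analysis.

Set Implicit Arguments.
Unset Strict Implicit.
Unset Printing Implicit Defensive.

Import Order.TTheory GRing.Theory Num.Theory.
Import numFieldNormedType.Exports.

Local Open Scope classical_set_scope.
Local Open Scope ring_scope.

(* x (x - 1) ... (x - n + 1) / n! for x an arbitrary integer; the division is
   exact. *)
Definition binz (x : int) (n : nat) : int :=
  ((\prod_(i < n) (x - i%:Z)) %/ (n`!)%:Z)%Z.

(* K_0(P_n) is free with basis the classes of O, O(1), ..., O(n), so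
   'cV[int]_n.+1 is K_0(P_n) and 'cV[R]_n.+1 is K_0(P_n) (x) R, in coordinates
   with respect to this basis.  The (i, j) entry below is chi(O(i), O(j)). *)
Definition euler_gram (n : nat) : 'M[int]_n.+1 :=
  \matrix_(i, j) binz (n%:Z + (j : nat)%:Z - (i : nat)%:Z) n.

(* For S = int this is the Euler form on K_0(P_n), and for a realType S it is
   its S-bilinear extension to K_0(P_n) (x) S: see euler_form_intr. *)
Definition euler_form (S : comNzRingType) (n : nat) (x y : 'cV[S]_n.+1) : S :=
  (x^T *m map_mx intr (euler_gram n) *m y) 0 0.

Definition IsomK0 (S : comUnitRingType) (n : nat) : set 'M[S]_n.+1 :=
  [set g | g \in unitmx /\
           forall x y, euler_form (g *m x) (g *m y) = euler_form x y].
Arguments IsomK0 : clear implicits.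

Definition IsomK0R_e (R : realType) (n : nat) : set 'M[R]_n.+1 :=
  connected_component (IsomK0 R n) 1%:M.
Arguments IsomK0R_e : clear implicits.

Definition IsomK0_e (R : realType) (n : nat) : set 'M[int]_n.+1 :=
  IsomK0 int n `&` [set g | IsomK0R_e R n (map_mx intr g)].
Arguments IsomK0_e : clear implicits.

Lemma binz_nat (m n : nat) : binz m%:Z n = ('C(m, n))%:Z.
Proof.
rewrite /binz.
have -> : \prod_(i < n) (m%:Z - i%:Z) = (m ^_ n)%:Z.
  elim: n => [|n IHn]; first by rewrite big_ord0.
  rewrite big_ord_recr /= IHn ffactnSr PoszM.
  case: (leqP n m) => [le_nm|lt_mn]; first by rewrite -subzn.
  by rewrite ffact_small // !mul0r.
by rewrite -bin_ffact PoszM mulzK // eqz_nat -lt0n fact_gt0.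
Qed.

Lemma euler_gramE (n : nat) (i j : 'I_n.+1) :
  euler_gram n i j = ('C(n + j - i, n))%:Z.
Proof.
rewrite mxE -PoszD subzn ?binz_nat //.
by rewrite (leq_trans _ (leq_addr _ _)) // -ltnS.
Qed.

Lemma euler_form_delta (n : nat) (i j : 'I_n.+1) :
  euler_form (delta_mx i 0 : 'cV[int]_n.+1) (delta_mx j 0) = euler_gram n i j.
Proof.
by rewrite /euler_form trmx_delta -rowE -colE !mxE intz.
Qed.

Lemma euler_form_intr (S : comNzRingType) (n : nat) (x y : 'cV[int]_n.+1) :
  euler_form (map_mx intr x : 'cV[S]_n.+1) (map_mx intr y)
  = (euler_form x y)%:~R.
Proof.
have id_gram : map_mx intr (euler_gram n) = euler_gram n :> 'M[int]_n.+1.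
  by apply/matrixP => i j; rewrite mxE intz.
by rewrite /euler_form id_gram map_trmx -!map_mxM mxE.
Qed.

(* Main.v *)
(* Let G be the Gram matrix of the Euler form.  Isometries commute with the
   canonical operator G^-T G.  By Serre duality (-1)^n G^-T G is the twist K by
   O(n+1), and N = K - 1 is nilpotent with a single Jordan block, so over a
   field every isometry is a polynomial in N.  The adjoint of N is -K^-1 N, so
   an isometry has constant term 1 or -1, and it is in the identity component
   iff this term is 1: the constant term is continuous, and the Cayley transform
   joins a unipotent isometry to 1.

   The integral unipotent isometries are filtered by the order of vanishing of
   g - 1 at N = 0.  The leading coefficient is additive and takes values in a
   lattice; comparing g with its adjoint shows that it vanishes in even degree,
   while p (p^* )^-1 with p = 1 + N^k has leading coefficient 2 in odd degree k.
   So the graded pieces are infinite cyclic for odd k <= n and trivial for even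
   k, and the group is free abelian of rank [(n+1)/2]. *)
Require Import Defs.
From HB Require Import structures.
From mathcomp Require Import all_boot all_order all_algebra.
From mathcomp Require Import all_classical all_reals all_analysis.
From mathcomp Require Import zify.

Import Order.TTheory GRing.Theory Num.Theory.
Import numFieldNormedType.Exports.

Local Open Scope classical_set_scope.
Local Open Scope ring_scope.

(** * Free abelian groups from a filtration by kernels of integer characters *)

(** The image of each [c i] is a nonzero subgroup of Z, hence free, so [U i] splits as this image
    times the kernel [U i.+1]; induction on m collects the cyclic factors. *)
Lemma filtered_group_free (M : unitRingType) (m : nat)
    (U : nat -> set M) (c : nat -> M -> int) :
  (forall i, U i 1) ->
  (forall i x y, U i x -> U i y -> U i (x * y)) ->
  (forall i x, U i x -> U i x^-1) ->
  (forall i x, U i x -> x \is a GRing.unit) ->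
  (forall i x y, U i x -> U i y -> x * y = y * x) ->
  (forall i x y, (i < m)%N -> U i x -> U i y -> c i (x * y) = c i x + c i y) ->
  (forall i x, (i < m)%N -> U i.+1 x <-> U i x /\ c i x = 0) ->
  (forall i, (i < m)%N -> exists2 x, U i x & c i x != 0) ->
  (forall x, U m x -> x = 1) ->
  exists f : 'rV[int]_m -> M,
    (forall u v, f (u + v) = f u * f v) /\ set_bij [set: 'rV[int]_m] (U 0%N) f.
Proof.
elim: m U c => [|m IHm] U c U1 UM UV Uu Uc cM cS cN Um.
  exists (fun=> 1); split; first by move=> u v; rewrite mulr1.
  split=> [u _|u v _ _ _|x /Um ->]; first exact: U1.
    by rewrite (thinmx0 u) (thinmx0 v).
  by exists 0.
have [f' [f'D [f'U f'I f'S]]] := IHm (fun i => U i.+1) (fun i => c i.+1)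
  (fun i => U1 _) (fun i => UM _) (fun i => UV _) (fun i => Uu _)
  (fun i => Uc _) (fun i x y im => cM i.+1 x y im) (fun i x im => cS i.+1 x im)
  (fun i im => cN i.+1 im) Um.
have c1 : c 0%N 1 = 0.
  have := cM 0%N 1 1 isT (U1 _) (U1 _).
  by rewrite mulr1 => /eqP; rewrite -[X in X == _]addr0 (inj_eq (addrI _)) => /eqP.
have cV x : U 0%N x -> c 0%N x^-1 = - c 0%N x.
  move=> Ux; apply/eqP; rewrite -addr_eq0 -cM //; last exact: UV.
  by rewrite mulVr ?c1 //; apply: Uu Ux.
have UX x z : U 0%N x -> U 0%N (x ^ z).
  have UXn y k : U 0%N y -> U 0%N (y ^+ k).
    by move=> Uy; elim: k => [|k IHk]; [exact: U1 | rewrite exprS; apply: UM].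
  by case: z => k Ux; [exact: UXn | apply/UV/UXn].
have cX x z : U 0%N x -> c 0%N (x ^ z) = c 0%N x * z.
  have cXn y k : U 0%N y -> c 0%N (y ^+ k) = c 0%N y * k%:Z.
    move=> Uy; elim: k => [|k IHk]; first by rewrite mulr0.
    rewrite exprS cM //; last exact: (UX y k).
    by rewrite IHk intS mulrDr mulr1.
  case: z => k Ux; first exact: cXn.
  rewrite NegzE -exprnN cV; last exact: (UX x k.+1).
  by rewrite cXn // mulrN.
(* The shift [d.+1] builds in positivity: the least positive value of [c 0] generates its image, and
   [g] attains it. *)
pose Q d := `[< exists2 x, U 0%N x & c 0%N x = d.+1%:Z >].
have exQ : exists d, Q d.
  have [x Ux cx] := cN 0%N isT.
  case E : (c 0%N x) cx => [[|d]|d] // _.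
    by exists d; apply/asboolP; exists x.
  exists d; apply/asboolP; exists x^-1; first exact: UV.
  by rewrite cV // E NegzE opprK.
case: (ex_minnP exQ) => d /asboolP[g Ug cg] dmin.
have dvd_c x : U 0%N x -> exists q, c 0%N (g ^ (- q) * x) = 0.
  move=> Ux; exists (c 0%N x %/ d.+1%:Z)%Z.
  have Uy := UM 0%N _ x (UX g (- (c 0%N x %/ d.+1%:Z)%Z) Ug) Ux.
  have cy : c 0%N (g ^ (- (c 0%N x %/ d.+1%:Z)%Z) * x) = (c 0%N x %% d.+1%:Z)%Z.
    rewrite cM ?cX //; last exact: UX.
    by rewrite cg {2}(divz_eq (c 0%N x) d.+1%:Z) mulrN [d.+1%:Z * _]mulrC addKr.
  have r0 : 0 <= (c 0%N x %% d.+1%:Z)%Z by rewrite modz_ge0.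
  have rd : (c 0%N x %% d.+1%:Z)%Z < d.+1%:Z by exact: ltz_pmod.
  (* The remainder is itself a value of [c 0] below [d.+1], so minimality forces it to be 0. *)
  rewrite cy; case E : (c 0%N x %% d.+1%:Z)%Z r0 rd => [[|r]|r] //= _.
  rewrite ltz_nat ltnS ltnNge => /negP[]; apply: dmin; apply/asboolP.
  by exists (g ^ (- (c 0%N x %/ d.+1%:Z)%Z) * x); rewrite // cy E.
have ug : g \is a GRing.unit by exact: Uu Ug.
have U10 x : U 1%N x -> U 0%N x by case/cS.
have f'0 w : U 0%N (f' w) by apply/U10/f'U.
pose f (v : 'rV[int]_m.+1) : M :=
  g ^ (v 0 0) * f' (rsubmx (v : 'M[int]_(1, 1 + m))).
exists f; split=> [u v|].
  rewrite /f mxE exprzDr // (linearD (@rsubmx int 1 1 m)) f'D !mulrA; congr (_ * _).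
  by rewrite -!mulrA; congr (_ * _); apply: (Uc 0%N) => //; apply: UX.
split=> [v _|u v _ _|x Ux].
- by apply: UM; [exact: UX | exact: f'0].
- rewrite /f => E; have E0 : u 0 0 = v 0 0.
    have := congr1 (c 0%N) E; rewrite !cM ?cX //; try exact: UX.
    have cf' w : c 0%N (f' w) = 0 by case/cS: (f'U w I).
    by rewrite !cf' !addr0 => /mulfI; apply; rewrite cg.
  move: E; rewrite E0 => /mulrI E1; have {}E1 := E1 (unitrXz _ ug).
  have /f'I E2 := E1; have {}E2 := E2 (mem_setT _) (mem_setT _).
  have E3 : lsubmx (u : 'M[int]_(1, 1 + m)) = lsubmx (v : 'M[int]_(1, 1 + m)).
    apply/rowP => j; rewrite !mxE !ord1.
    by have -> : lshift m (0 : 'I_1) = 0 by apply/val_inj.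
  have := hsubmxK (v : 'M[int]_(1, 1 + m)); rewrite -E2 -E3 => <-.
  by rewrite hsubmxK.
- have [q cq] := dvd_c x Ux.
  have /f'S[w _ fw] : U 1%N (g ^ (- q) * x).
    by apply/cS=> //; split=> //; apply: UM => //; apply: UX.
  exists (row_mx (q%:M) w : 'rV_(1 + m)) => //; rewrite /f row_mxKr fw.
  have -> : (row_mx q%:M w : 'rV_(1 + m)) 0 0 = q.
    have -> : 0 = lshift m 0 :> 'I_(1 + m) by apply/val_inj.
    by rewrite row_mxEl mxE eqxx.
  by rewrite mulrA -exprzDr // subrr mul1r.
Qed.

(** * Serre duality and the twist by O(n+1) in matrix form *)

(* The binomial coefficient [binz], in a form without integer division. *)
Definition binomz (x : int) (k : nat) : int :=
  match x with
  | Posz m => ('C(m, k))%:Z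
  | Negz m => (-1) ^+ k * ('C(m + k, k))%:Z
  end.

Lemma binomz0 (x : int) : binomz x 0 = 1.
Proof. by case: x => m /=; rewrite bin0 // expr0. Qed.

(** Pascal's rule over all integers makes the twist by O(1) act on [binom_mx]. The case x = -1 is
    separate because x + 1 changes constructor. *)
Lemma binomzS (x : int) (k : nat) :
  binomz (x + 1) k.+1 = binomz x k.+1 + binomz x k.
Proof.
case: x => [m|[|m]].
- by rewrite -PoszD addn1 /= binS PoszD.
- by rewrite NegzE addNr /= !add0n !binn !mulr1 exprS mulN1r addNr.
- have -> : Negz m.+1 + 1 = Negz m by lia.
  rewrite /= addSn binS PoszD addSnnS exprS mulN1r !mulNr mulrDr opprD.
  by rewrite -addrA addNr addr0.
Qed.

Section SerreOperator.

Variable n : nat.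

Definition shift_mx : 'M[int]_n.+1 := \matrix_(l, k) (l == k.+1 :> nat)%:R.

Lemma shift_mxX (m : nat) (l k : 'I_n.+1) :
  (shift_mx ^+ m) l k = (l == (k + m)%N :> nat)%:R.
Proof.
elim: m k => [|m IHm] k; first by rewrite expr0 mxE addn0.
rewrite exprSr mxE; have [lt_kn|ge_kn] := ltnP k n.
  have lt_k1 : (k.+1 < n.+1)%N by [].
  rewrite (bigD1 (Ordinal lt_k1)) //= big1 => [|i ne_i].
    by rewrite !mxE IHm eqxx mulr1 addr0 /= addSnnS.
  rewrite !mxE [_ == _](_ : _ = false) ?mulr0 //; apply: contraNF ne_i => /eqP e.
  exact/eqP/val_inj.
rewrite big1 => [|i _].
  rewrite (_ : _ == _ = false) //; apply/negbTE; rewrite neq_ltn.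
  by rewrite (leq_trans (ltn_ord l)) // addnS ltnS (leq_trans ge_kn) ?leq_addr.
rewrite !mxE (_ : _ == _ = false) ?mulr0 //; apply/negbTE; rewrite neq_ltn.
by rewrite (leq_trans (ltn_ord i)).
Qed.

Lemma shift_mx_nilp : shift_mx ^+ n.+1 = 0.
Proof.
apply/matrixP => l k; rewrite shift_mxX !mxE (_ : _ == _ = false) //.
by apply/negbTE; rewrite neq_ltn (leq_trans (ltn_ord l)) // leq_addl.
Qed.

(* The columns of [basis_mx] are the classes of O, O(1), ..., O(n) in the basis
   (T - 1)^k [O], where T is the twist by O(1); in the latter basis T is
   [1 + shift_mx]. *)
Definition basis_mx : 'M[int]_n.+1 :=
  \matrix_(l, j) ((1 + shift_mx) ^+ j) l 0.

(** The entry is chi(O(i), (T - 1)^k [O(m)]): each difference in the argument of a binomial lowers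
    its lower index by one. *)
Definition binom_mx (m : int) : 'M[int]_n.+1 :=
  \matrix_(i, k) binomz (n%:Z - i%:Z + m) (n - k).

Lemma binom_mx_twist (m : int) :
  binom_mx m * (1 + shift_mx) = binom_mx (m + 1).
Proof.
rewrite mulrDr mulr1; apply/matrixP => i k; rewrite !mxE addrA.
have [lt_kn|ge_kn] := ltnP k n.
  have lt_k1 : (k.+1 < n.+1)%N by [].
  rewrite (bigD1 (Ordinal lt_k1)) //= big1 => [|l ne_l].
    by rewrite !mxE eqxx mulr1 addr0 -(subnSK lt_kn) binomzS.
  rewrite !mxE [_ == _](_ : _ = false) ?mulr0 //; apply: contraNF ne_l => /eqP e.
  exact/eqP/val_inj.
have -> : (n - k = 0)%N by apply/eqP.
rewrite !binomz0 big1 ?addr0 // => l _.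
rewrite !mxE (_ : _ == _ = false) ?mulr0 //; apply/negbTE; rewrite neq_ltn.
by rewrite (leq_trans (ltn_ord l)).
Qed.

Lemma binom_mx_twistX (m : int) (k : nat) :
  binom_mx m * (1 + shift_mx) ^+ k = binom_mx (m + k%:Z).
Proof.
elim: k => [|k IHk]; first by rewrite mulr1 addr0.
by rewrite exprSr mulrA IHk binom_mx_twist -addrA -PoszD addn1.
Qed.

Lemma binom_mx_basis (m : int) (i j : 'I_n.+1) :
  (binom_mx m * basis_mx) i j = binomz (n%:Z - i%:Z + (m + j%:Z)) n.
Proof.
transitivity ((binom_mx m * (1 + shift_mx) ^+ j) i 0).
  by rewrite !mxE; apply: eq_bigr => l _; rewrite !mxE.
by rewrite binom_mx_twistX mxE subn0.
Qed.

Lemma euler_gram_unit : euler_gram n \is a GRing.unit.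
Proof.
rewrite [_ \is a _]unitmxE -det_tr det_trig.
  by apply: rpred_prod => i _; rewrite mxE euler_gramE addnK binn.
apply/is_trig_mxP => i j lt_ij; rewrite mxE euler_gramE bin_small //.
by have := ltn_ord j; lia.
Qed.

Lemma euler_gram_basis : euler_gram n = binom_mx 0 * basis_mx.
Proof.
apply/matrixP => i j; rewrite binom_mx_basis euler_gramE add0r.
have le_in : (i <= n)%N by rewrite -ltnS.
by rewrite subzn // -PoszD addnBAC.
Qed.

(** This is the reflection formula binom(-a - 1, n) = (-1)^n binom(a + n, n) with a = i - j; for i <
    j both sides vanish. *)
Lemma euler_gram_tr :
  (euler_gram n)^T = (-1) ^+ n *: (binom_mx (- n.+1%:Z) * basis_mx).
Proof.
apply/matrixP => i j; rewrite mxE [RHS]mxE binom_mx_basis euler_gramE.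
have -> : n%:Z - i%:Z + (- n.+1%:Z + j%:Z) = j%:Z - i.+1%:Z by lia.
have lt_jn := ltn_ord j; have [lt_ij|le_ji] := ltnP i j.
  by rewrite subzn //= !bin_small ?mulr0 //; lia.
have -> : j%:Z - i.+1%:Z = Negz (i - j) by lia.
by rewrite /= mulrA -exprD addnn -mul2n exprM sqrrN expr1n mul1r addnBAC // (addnC i).
Qed.

Lemma basis_mx_unit : basis_mx \is a GRing.unit.
Proof.
have := euler_gram_unit; rewrite euler_gram_basis [_ \is a _]unitmx_mul.
by case/andP.
Qed.

(** The twist by O(n+1), carried from the basis (T - 1)^k [O] to the basis of the O(j). *)
Definition serre_mx : 'M[int]_n.+1 :=
  basis_mx^-1 * (1 + shift_mx) ^+ n.+1 * basis_mx.

(* Serre duality: chi(F, E) = (-1)^n chi(E, F(-n-1)). *)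
Lemma serre_duality :
  (euler_gram n)^T * serre_mx = (-1) ^+ n *: euler_gram n.
Proof.
rewrite euler_gram_tr /serre_mx -scalerAl !mulrA mulrK ?basis_mx_unit //.
by rewrite binom_mx_twistX addNr -euler_gram_basis.
Qed.

Lemma conj_subr1X (x y : 'M[int]_n.+1) (k : nat) : x \is a GRing.unit ->
  (x^-1 * y * x - 1) ^+ k = x^-1 * (y - 1) ^+ k * x.
Proof.
move=> ux; have -> : x^-1 * y * x - 1 = x^-1 * (y - 1) * x.
  by rewrite mulrBr mulrBl mulr1 mulVr.
elim: k => [|k IHk]; first by rewrite !expr0 mulr1 mulVr.
by rewrite !exprS IHk !mulrA mulrK.
Qed.

Lemma twist_subr1X (k : nat) : ((1 + shift_mx) ^+ n.+1 - 1) ^+ k =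
  shift_mx ^+ k * (\sum_(i < n.+1) (1 + shift_mx) ^+ i) ^+ k.
Proof.
rewrite subrX1 [1 + _]addrC addrK exprMn_comm //; apply: commr_sum => i _.
by apply: commrX; apply: commrD; [exact: commr_refl | exact: commr1].
Qed.

Lemma serre_mx_nilp : (serre_mx - 1) ^+ n.+1 = 0.
Proof.
rewrite conj_subr1X ?basis_mx_unit // twist_subr1X shift_mx_nilp.
by rewrite mul0r mulr0 mul0r.
Qed.

(** Multiplication by 1 + [shift_mx] fixes [shift_mx ^+ n], so the power is conjugate to (n+1)^n
    times [shift_mx ^+ n]. *)
Lemma serre_mx_cyclic : (serre_mx - 1) ^+ n != 0.
Proof.
have ub := basis_mx_unit; rewrite conj_subr1X // twist_subr1X.
have shiftT (k : nat) : shift_mx ^+ n * (1 + shift_mx) ^+ k = shift_mx ^+ n.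
  elim: k => [|k IHk]; first by rewrite mulr1.
  by rewrite exprSr mulrA IHk mulrDr mulr1 -exprSr shift_mx_nilp addr0.
have shiftX (k : nat) :
    shift_mx ^+ n * (\sum_(i < n.+1) (1 + shift_mx) ^+ i) ^+ k
    = shift_mx ^+ n *+ n.+1 ^ k.
  elim: k => [|k IHk]; first by rewrite mulr1.
  rewrite exprSr mulrA IHk mulrnAl mulr_sumr.
  under eq_bigr do rewrite shiftT.
  by rewrite sumr_const card_ord -mulrnA expnS.
rewrite shiftX; apply/negP => /eqP/(congr1 (fun z => basis_mx * z * basis_mx^-1)).
rewrite mulr0 mul0r -!mulrA divrr // mulr1 mulVKr //.
move/matrixP/(_ ord_max 0).
rewrite mulmxnE shift_mxX mxE add0n eqxx => /eqP.
by rewrite pnatr_eq0 expn_eq0.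
Qed.

End SerreOperator.

(** * Adjoints for the Euler form over a commutative ring *)

Section Adjoint.

Variables (S : comUnitRingType) (n : nat).
Implicit Types x y g : 'M[S]_n.+1.

Definition gramS : 'M[S]_n.+1 := map_mx intr (euler_gram n).
Definition serreS : 'M[S]_n.+1 := map_mx intr (serre_mx n).
Definition nilpS : 'M[S]_n.+1 := map_mx intr (serre_mx n - 1).

Local Notation G := gramS.
Local Notation K := serreS.
Local Notation N := nilpS.

Lemma gramS_unit : G \is a GRing.unit.
Proof. exact/rmorph_unit/euler_gram_unit. Qed.

Lemma serreS_duality : G^T * K = (-1) ^+ n *: G.
Proof.
rewrite /gramS /serreS map_trmx.
rewrite -[LHS](rmorphM (map_mx (intr : int -> S))) serre_duality /= map_mxZ.
by rewrite rmorphXn rmorphN1.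
Qed.

Lemma nilpSE : N = K - 1.
Proof. by rewrite /nilpS [LHS]rmorphB /= rmorph1. Qed.

Lemma nilpS_nilp : N ^+ n.+1 = 0.
Proof. by rewrite /nilpS -rmorphXn /= serre_mx_nilp rmorph0. Qed.

Lemma nilpS_ge (m : nat) : (n < m)%N -> N ^+ m = 0.
Proof. by move=> /subnK <-; rewrite exprD nilpS_nilp mulr0. Qed.

(** The right adjoint: chi(x u, v) = chi(u, adj x v). The form is not symmetric in general, so
    taking adjoints need not be an involution. *)
Definition adjoint x : 'M[S]_n.+1 := G^-1 * x^T * G.
Local Notation adj := adjoint.

Lemma adjointM x y : adj (x * y) = adj y * adj x.
Proof.
rewrite /adj !mulrA mulrK ?gramS_unit // -!mulrA; congr (_ * _).
by rewrite !mulrA; congr (_ * _); exact: trmx_mul.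
Qed.

Lemma adjoint1 : adj 1 = 1.
Proof. by rewrite /adj [1^T]trmx1 mulr1 mulVr // gramS_unit. Qed.

Lemma adjointD x y : adj (x + y) = adj x + adj y.
Proof. by rewrite /adj linearD /= mulrDr mulrDl. Qed.

Lemma adjointZ (a : S) x : adj (a *: x) = a *: adj x.
Proof. by rewrite /adj linearZ /= -scalerAr -scalerAl. Qed.

Lemma adjointB x y : adj (x - y) = adj x - adj y.
Proof. by rewrite -scaleN1r adjointD adjointZ scaleN1r. Qed.

Lemma adjointX x (k : nat) : adj (x ^+ k) = adj x ^+ k.
Proof.
by elim: k => [|k IHk]; rewrite ?adjoint1 // exprS adjointM IHk exprSr.
Qed.

Lemma adjoint_unit x : x \is a GRing.unit -> adj x \is a GRing.unit.
Proof.
move=> ux; apply/unitrP; exists (adj x^-1).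
by rewrite -!adjointM mulVr // mulrV // adjoint1.
Qed.

Lemma adjointV x : x \is a GRing.unit -> adj x^-1 = (adj x)^-1.
Proof.
move=> ux; apply: (mulrI (adjoint_unit x ux)).
by rewrite -adjointM mulVr // adjoint1 mulrV // adjoint_unit.
Qed.

(** Serre duality is used twice and its two signs cancel: the twist is an isometry. *)
Lemma adjoint_serreS_mul : adj K * K = 1.
Proof.
have KG : K^T * G = (-1) ^+ n *: G^T.
  by have := congr1 trmx serreS_duality; rewrite [LHS]trmx_mul trmxK linearZ.
rewrite /adj -(mulrA _ K^T) KG -mulrA -scalerAl serreS_duality scalerA.
by rewrite -exprMn mulN1r opprK expr1n scale1r mulVr // gramS_unit.
Qed.

Lemma serreS_unit : K \is a GRing.unit.
Proof. by have [] := mulmx1_unit adjoint_serreS_mul. Qed.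

Lemma adjoint_serreS : adj K = K^-1.
Proof.
apply: (mulIr serreS_unit); rewrite adjoint_serreS_mul mulVr //.
exact: serreS_unit.
Qed.

(** The double adjoint is conjugation by G^-T G, which Serre duality identifies with (-1)^n K; the
    sign cancels. *)
Lemma adjointK x : adj (adj x) = K^-1 * x * K.
Proof.
have uG := gramS_unit; have uK := serreS_unit.
have uGT : G^T \is a GRing.unit by rewrite [_ \is a _]unitmx_tr.
have sgn : (-1) ^+ n * (-1) ^+ n = 1 :> S by rewrite -exprMn mulN1r opprK expr1n.
have GGT : G^-1 * G^T = (-1) ^+ n *: K^-1.
  apply: (mulIr uK); rewrite -mulrA serreS_duality -scalerAr mulVr //.
  by rewrite -scalerAl mulVr.
have GTG : (G^T)^-1 * G = (-1) ^+ n *: K.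
  apply: (mulrI uGT); rewrite mulVKr // -scalerAr serreS_duality scalerA.
  by rewrite sgn scale1r.
have -> : adj (adj x) = (G^-1 * G^T) * x * ((G^T)^-1 * G).
  have -> : adj (adj x) = G^-1 * (adj x)^T * G by [].
  have -> : (adj x)^T = G^T * x * (G^T)^-1.
    rewrite /adj [LHS]trmx_mul [(_ * _)^T]trmx_mul trmxK.
    by rewrite [(G^-1)^T]trmx_inv -mulrA.
  by rewrite !mulrA.
by rewrite GGT GTG -!scalerAl -scalerAr scalerA sgn scale1r.
Qed.

Lemma IsomK0P g : IsomK0 S n g <-> adj g * g = 1.
Proof.
have entryE (A : 'M[S]_n.+1) i j :
    ((delta_mx i 0 : 'cV[S]_n.+1)^T *m A *m (delta_mx j 0 : 'cV[S]_n.+1)) 0 0 = A i j.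
  by rewrite trmx_delta -rowE -colE !mxE.
have formE : (forall u v : 'cV[S]_n.+1,
    euler_form (g *m u) (g *m v) = euler_form u v) <-> g^T * G * g = G.
  split=> [gE|gE u v]; last first.
    by rewrite /euler_form trmx_mul -/gramS -[in RHS]gE !mulmxA.
  apply/matrixP => i j; rewrite -entryE -[RHS]entryE.
  have := gE (delta_mx i 0) (delta_mx j 0); rewrite /euler_form -/gramS => <-.
  by rewrite trmx_mul !mulmxA.
have uG := gramS_unit.
split=> [[_ /formE gE]|gE].
  by rewrite /adj -(mulrA _ g^T) -(mulrA G^-1) gE mulVr.
split; first by have [] := mulmx1_unit gE.
apply/formE; apply: (mulrI (_ : G^-1 \is a GRing.unit)); first by rewrite unitrV.
by rewrite mulVr // !mulrA.
Qed.

Lemma IsomK0_unit g : IsomK0 S n g -> g \is a GRing.unit.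
Proof. by case. Qed.

Lemma IsomK0_adjoint g : IsomK0 S n g -> adj g = g^-1.
Proof.
move=> ig; have ug := IsomK0_unit g ig; apply: (mulIr ug).
by rewrite mulVr //; apply/IsomK0P.
Qed.

Lemma IsomK0_1 : IsomK0 S n 1.
Proof. by apply/IsomK0P; rewrite adjoint1 mulr1. Qed.

Lemma IsomK0_mul g h : IsomK0 S n g -> IsomK0 S n h -> IsomK0 S n (g * h).
Proof.
move=> /IsomK0P gE /IsomK0P hE; apply/IsomK0P.
by rewrite adjointM -mulrA [adj g * _]mulrA gE mul1r.
Qed.

Lemma IsomK0_inv g : IsomK0 S n g -> IsomK0 S n g^-1.
Proof.
move=> ig; have ug := IsomK0_unit g ig; apply/IsomK0P.
by rewrite adjointV // IsomK0_adjoint // invrK mulrV.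
Qed.

Lemma comm_nilpS x : GRing.comm x N <-> GRing.comm x K.
Proof.
have KE : K = N + 1 by rewrite nilpSE subrK.
split=> xN; first by rewrite KE; apply: commrD => //; exact: commr1.
by rewrite nilpSE; apply: commrB => //; exact: commr1.
Qed.

(* The double adjoint is conjugation by K, and it fixes isometries. *)
Lemma IsomK0_comm g : IsomK0 S n g -> GRing.comm g N.
Proof.
move=> ig; have ug := IsomK0_unit g ig; have uK := serreS_unit.
have := adjointK g; rewrite (IsomK0_adjoint g ig) adjointV // (IsomK0_adjoint g ig).
by rewrite invrK => E; apply/comm_nilpS; rewrite /GRing.comm [in RHS]E mulrA mulVKr.
Qed.

Lemma adjoint_nilpS : adj N = - (K^-1 * N).
Proof.
rewrite nilpSE adjointB adjoint_serreS adjoint1 mulrBr mulVr ?serreS_unit //.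
by rewrite mulr1 opprB.
Qed.

Lemma serreSV_comm : GRing.comm K^-1 N.
Proof. by apply/comm_nilpS; apply/commr_sym/commrV/commr_refl. Qed.

Lemma adjoint_comm x : GRing.comm x N -> GRing.comm (adj x) N.
Proof.
move=> /comm_nilpS xK; apply/comm_nilpS; rewrite -[K]invrK; apply: commrV.
by rewrite /GRing.comm -adjoint_serreS -!adjointM xK.
Qed.

(** As K = 1 + N and N^(n+1) = 0, factors K^-1 disappear in top degree. *)
Lemma nilpS_top_serre : K^-1 * N ^+ n = N ^+ n.
Proof.
apply: (mulrI serreS_unit); rewrite mulVKr ?serreS_unit //.
by rewrite -[K](subrK 1) -nilpSE mulrDl mul1r -exprS nilpS_nilp add0r.
Qed.

Lemma nilpS_top_serreX (k : nat) : K^-1 ^+ k * N ^+ n = N ^+ n.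
Proof.
by elim: k => [|k IHk]; rewrite ?mul1r // exprSr -mulrA nilpS_top_serre.
Qed.

Lemma adjoint_nilpSX (k : nat) :
  adj N ^+ k = (-1) ^+ k *: (K^-1 ^+ k * N ^+ k).
Proof.
rewrite adjoint_nilpS -scaleN1r exprZn exprMn_comm //.
exact: serreSV_comm.
Qed.

(** The relation N^(n-k) x = a N^n encodes, without division, a leading term a N^k of x. Since adj N
    = -K^-1 N agrees with -N to first order, the adjoint multiplies a by (-1)^k. *)
Lemma adjoint_lead x (k : nat) (a : S) : (k <= n)%N -> GRing.comm x N ->
  N ^+ (n - k) * x = a *: N ^+ n ->
  N ^+ (n - k) * adj x = ((-1) ^+ k * a) *: N ^+ n.
Proof.
move=> le_kn xN /(congr1 adj); rewrite adjointM adjointZ !adjointX !adjoint_nilpSX.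
(* [L] commutes with [adj x], is absorbed by N^n and is finally cancelled; the signs combine to
   (-1)^(n-k) (-1)^n = (-1)^k. *)
rewrite nilpS_top_serreX; set L := K^-1 ^+ (n - k).
have uL : L \is a GRing.unit by rewrite unitrX // unitrV serreS_unit.
have xL : adj x * L = L * adj x.
  apply: commrX; apply: commrV; apply/comm_nilpS; exact: adjoint_comm.
have xNk : N ^+ (n - k) * adj x = adj x * N ^+ (n - k).
  by apply/commr_sym/commrX; exact: adjoint_comm.
rewrite -scalerAr mulrA xL -mulrA -xNk => E; apply: (mulrI uL).
have sgn : (-1) ^+ (n - k) * (-1) ^+ (n - k) = 1 :> S.
  by rewrite -exprMn mulN1r opprK expr1n.
rewrite -[LHS]scale1r -[X in X *: _ = _]sgn
  -(scalerA ((-1) ^+ (n - k))) E -scalerAr nilpS_top_serreX !scalerA.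
congr (_ *: _); rewrite -mulrA mulrCA mulrC; congr (_ * _).
by rewrite -{2}(subnK le_kn) exprD mulrA sgn mul1r.
Qed.

Lemma unit_sub_nilp (x : 'M[S]_n.+1) (m : nat) : x ^+ m = 0 ->
  1 - x \is a GRing.unit.
Proof.
move=> xm; have E : (1 - x) * (\sum_(i < m) x ^+ i) = 1.
  by rewrite -opprB mulNr -subrX1 xm sub0r opprK.
by have [] := mulmx1_unit E.
Qed.

(** Let q be the adjoint of p = 1 + N^k. As p commutes with K, the adjoint of q is p; as p and q
    also commute, p q^-1 is an isometry. *)
Lemma IsomK0_exists_lead (k : nat) : odd k -> (k <= n)%N ->
  exists2 g, IsomK0 S n g & N ^+ (n - k) * (g - 1) = N ^+ n *+ 2.
Proof.
move=> odd_k le_kn; have k_gt0 : (0 < k)%N by case: k odd_k {le_kn}.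
pose p : 'M[S]_n.+1 := 1 + N ^+ k; pose q := adj p.
have up : p \is a GRing.unit.
  rewrite /p -[N ^+ k]opprK; apply: (unit_sub_nilp _ n.+1).
  rewrite exprNn -exprM nilpS_ge ?mulr0 //.
  by rewrite (leq_trans _ (leq_pmull _ _)).
have uq : q \is a GRing.unit by exact: adjoint_unit.
have pN : GRing.comm p N.
  by apply/commr_sym/commrD; [exact: commr1 | apply/commrX/commr_refl].
have qN : GRing.comm q N by exact: adjoint_comm.
have pq : GRing.comm q p by apply: commrD; [exact: commr1 | exact: commrX].
have qq : adj q = p.
  rewrite /q adjointK -mulrA; have /comm_nilpS -> := pN.
  by rewrite mulKr ?serreS_unit.
(* Since k > 0, q is 1 up to a term that N^n kills. *)
have topq : N ^+ n * q = N ^+ n.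
  rewrite /q adjointD adjoint1 mulrDr mulr1 adjointX adjoint_nilpSX -scalerAr.
  have -> : K^-1 ^+ k * N ^+ k = N ^+ k * K^-1 ^+ k.
    by apply/commrX/commr_sym/commrX/commr_sym/serreSV_comm.
  have lt_nk : (n < n + k)%N by lia.
  by rewrite mulrA -exprD (nilpS_ge _ lt_nk) mul0r scaler0 addr0.
have topqV : N ^+ n * q^-1 = N ^+ n by apply: (mulIr uq); rewrite mulrVK ?topq.
exists (p * q^-1).
  apply/IsomK0P; rewrite adjointM adjointV // qq -/q -mulrA (mulrA q) pq.
  by rewrite -(mulrA p) mulrV // mulr1 mulVr.
have -> : p * q^-1 - 1 = (p - q) * q^-1 by rewrite mulrBl mulrV.
(* The leading coefficient of p - q is therefore 1 - (-1)^k = 2. *)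
have -> : p - q = N ^+ k - adj (N ^+ k).
  by rewrite /q /p adjointD adjoint1 opprD addrACA subrr add0r.
rewrite mulrA mulrBr -exprD subnK // (adjoint_lead _ _ 1) //.
- rewrite mulr1 -signr_odd odd_k expr1 scaleN1r opprK -mulr2n mulrnAl.
  by rewrite topqV.
- by apply/commr_sym/commrX/commr_refl.
- by rewrite -exprD subnK // scale1r.
Qed.

(** The adjoint keeps the constant term a, so adj g g = 1 makes a^2 act as 1 on N^n. *)
Lemma IsomK0_lead0 g (a : S) : IsomK0 S n g ->
  N ^+ n * g = a *: N ^+ n -> (a ^+ 2) *: N ^+ n = N ^+ n.
Proof.
move=> ig gE; have gN := IsomK0_comm g ig; move/IsomK0P: ig => ig.
have := adjoint_lead g 0 a (leq0n _) gN; rewrite subn0 expr0 mul1r => /(_ gE) E.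
by rewrite -[in RHS](mulr1 (N ^+ n)) -ig mulrA E -scalerAl gE scalerA.
Qed.

(** With X = adj g - 1 and Y = g - 1 the isometry condition reads X Y + X + Y = 0. In even degree X
    and Y share the leading coefficient a, and N^(n-k) kills the product, which leaves 2 a N^n =
    0. *)
Lemma IsomK0_even_lead g (k : nat) (a : S) : IsomK0 S n g ->
  N ^+ n * (g - 1) = 0 -> (k <= n)%N -> ~~ odd k ->
  N ^+ (n - k) * (g - 1) = a *: N ^+ n -> (a *+ 2) *: N ^+ n = 0.
Proof.
move=> ig g1 le_kn even_k gE; have gN := IsomK0_comm g ig.
have xN : GRing.comm (g - 1) N.
  by apply/commr_sym/commrB; [exact/commr_sym | exact: commr1].
have := adjoint_lead _ k a le_kn xN gE.
rewrite -signr_odd (negbTE even_k) expr0 mul1r adjointB adjoint1 => E.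
have /IsomK0P := ig; rewrite -[in X in _ * X](subrK 1 g).
rewrite -[adj g](subrK 1) mulrDl mulrDr !mulr1 mul1r addrA => /eqP.
rewrite eq_sym -subr_eq subrr.
move: (adj g - 1) (g - 1) E g1 gE => X Y E g1 gE.
move=> /eqP/(congr1 (fun z => N ^+ (n - k) * z)).
rewrite mulr0 !mulrDr mulrA E -scalerAl g1 scaler0 add0r gE => E2.
by rewrite mulr2n scalerDl -E2.
Qed.

End Adjoint.

(** * Centralizer of a nilpotent matrix with a single Jordan block *)

Section CyclicNilpotent.

Variables (F : fieldType) (n : nat) (N : 'M[F]_n.+1) (i0 j0 : 'I_n.+1).
Hypothesis N_nilp : N ^+ n.+1 = 0.
Hypothesis N_top : (N ^+ n) i0 j0 != 0.
Implicit Types x y : 'M[F]_n.+1.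

Lemma cyclic_nilp_ge (m : nat) : (n < m)%N -> N ^+ m = 0.
Proof. by move=> /subnK <-; rewrite exprD N_nilp mulr0. Qed.

(* The rows [row i0 (N ^+ k)] form a basis: pairing them with the columns
   [col j0 (N ^+ (n - l))] gives a triangular matrix. *)
Lemma cyclic_basis_unit :
  \matrix_k row i0 (N ^+ k) \in unitmx.
Proof.
pose C : 'M[F]_n.+1 := \matrix_(l', l) (N ^+ (n - l)) l' j0.
suff : \matrix_k row i0 (N ^+ k) *m C \in unitmx by rewrite unitmx_mul => /andP[].
have BCE (k l : 'I_n.+1) : (\matrix_k row i0 (N ^+ k) *m C) k l
    = (N ^+ (k + (n - l))) i0 j0.
  by rewrite exprD !mxE; apply: eq_bigr => l' _; rewrite !mxE.
rewrite unitmxE -det_tr det_trig.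
  apply: rpred_prod => k _; rewrite mxE BCE subnKC ?unitfE //.
  by rewrite -ltnS.
apply/is_trig_mxP => k l lt_kl; rewrite mxE BCE cyclic_nilp_ge ?mxE //.
by have := ltn_ord l; lia.
Qed.

(** The unit row vector at [i0] is cyclic for N, so a matrix commuting with N is determined by its
    row [i0]; the coefficients are those of this row in the basis of [cyclic_basis_unit]. *)
Lemma cyclic_nilp_centralizer x : GRing.comm x N ->
  exists a : 'rV[F]_n.+1, x = \sum_k a 0 k *: N ^+ k.
Proof.
move=> xN; pose B : 'M[F]_n.+1 := \matrix_k row i0 (N ^+ k).
have uB := cyclic_basis_unit.
exists (row i0 x *m invmx B); set a := _ *m _; set y := \sum_k _.
have yN : GRing.comm y N.
  apply/commr_sym/commr_sum => k _.
  by rewrite /GRing.comm -scalerAr -scalerAl -exprS -exprSr.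
have rE : row i0 (x - y) = 0.
  apply/eqP; rewrite linearB subr_eq0 /=; apply/eqP.
  have -> : row i0 x = a *m B by rewrite mulmxKV.
  by rewrite mulmx_sum_row linear_sum; apply: eq_bigr => k _; rewrite linearZ rowK.
apply/eqP; rewrite -subr_eq0; apply/eqP.
suff : B *m (x - y) = 0 by move/(congr1 (mulmx (invmx B))); rewrite mulKmx // mulmx0.
apply/row_matrixP => k; rewrite row_mul rowK row0 -row_mul.
have -> : N ^+ k *m (x - y) = (x - y) *m N ^+ k.
  by apply/commr_sym/commrX/commr_sym/commrB; exact: commr_sym.
by rewrite row_mul rE mul0mx.
Qed.

Lemma cyclic_nilp_comm x y :
  GRing.comm x N -> GRing.comm y N -> GRing.comm x y.
Proof.
move=> xN /cyclic_nilp_centralizer[a ->]; apply: commr_sum => k _.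
by rewrite /GRing.comm -scalerAr -scalerAl; congr (_ *: _); exact: commrX.
Qed.

Lemma cyclic_nilp_split x : GRing.comm x N ->
  exists a x', GRing.comm x' N /\ x = a *: 1 + N * x'.
Proof.
case/cyclic_nilp_centralizer => a xE.
exists (a 0 0), (\sum_(k < n) a 0 (lift 0 k) *: N ^+ k); split.
  apply/commr_sym/commr_sum => k _.
  by rewrite /GRing.comm -scalerAr -scalerAl -exprS -exprSr.
rewrite {1}xE big_ord_recl expr0; congr (_ + _); rewrite mulr_sumr.
by apply: eq_bigr => k _; rewrite -scalerAr -exprS.
Qed.

(** Induction on k: the constant term of the cofactor of N^k vanishes, by comparison at the nonzero
    entry of N^n, and one more factor N splits off. *)
Lemma cyclic_nilp_factor x (k : nat) : GRing.comm x N -> (k <= n.+1)%N ->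
  N ^+ (n.+1 - k) * x = 0 -> exists2 z, GRing.comm z N & x = N ^+ k * z.
Proof.
move=> xN; elim: k => [|k IHk] le_kn xE; first by exists x; rewrite ?mul1r.
have [||z zN zE] := IHk; first exact: ltnW.
  by rewrite subSn // exprS -mulrA -(subSS k) xE mulr0.
have [a [z' [z'N z'E]]] := cyclic_nilp_split z zN.
exists z' => //; suff a0 : a = 0.
  by rewrite zE z'E a0 scale0r add0r exprSr mulrA.
move: xE; rewrite subSS zE mulrA -exprD subnK // z'E mulrDr -scalerAr mulr1.
rewrite mulrA -exprSr N_nilp mul0r addr0 => /matrixP/(_ i0 j0)/eqP.
by rewrite !mxE mulf_eq0 (negbTE N_top) orbF => /eqP.
Qed.

Lemma cyclic_nilp_lead x (k : nat) : GRing.comm x N -> (k <= n)%N ->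
  N ^+ (n.+1 - k) * x = 0 -> exists a, N ^+ (n - k) * x = a *: N ^+ n.
Proof.
move=> xN le_kn xE; have [|z zN zE] := cyclic_nilp_factor x k xN _ xE.
  exact: leqW.
have [a [z' [_ z'E]]] := cyclic_nilp_split z zN.
exists a; rewrite zE mulrA -exprD subnK // z'E mulrDr -scalerAr mulr1.
by rewrite mulrA -exprSr N_nilp mul0r addr0.
Qed.

End CyclicNilpotent.

(** * The filtration of the integral isometries *)

Lemma serre_mx_top_entry (n : nat) :
  exists i j, ((serre_mx n - 1) ^+ n) i j != 0.
Proof. exact/matrix0Pn/serre_mx_cyclic. Qed.

Section IntegralIsometries.

Variable n : nat.
Implicit Types g h : 'M[int]_n.+1.

Local Notation Nz := (nilpS int n).

Lemma nilpS_int : Nz = serre_mx n - 1.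
Proof. by apply/matrixP => i j; rewrite mxE intz. Qed.

Section BaseChange.

Variable F : numFieldType.

(** Used over [rat], where leading coefficients can be extracted, and over the reals, for the
    identity component. *)
Definition base_change g : 'M[F]_n.+1 := map_mx intr g.
Local Notation phi := base_change.
Local Notation N := (nilpS F n).

Lemma base_changeM g h : phi (g * h) = phi g * phi h.
Proof. exact: rmorphM. Qed.

Lemma base_changeB g h : phi (g - h) = phi g - phi h.
Proof. exact: rmorphB. Qed.

Lemma base_change1 : phi 1 = 1.
Proof. exact: rmorph1. Qed.

Lemma base_change0 : phi 0 = 0.
Proof. exact: rmorph0. Qed.

Lemma base_change_inj : injective phi.
Proof.
move=> g h /matrixP E; apply/matrixP => i j; apply: (@intr_inj F).
by have := E i j; rewrite !mxE.
Qed.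

Lemma base_change_nilpSX (k : nat) : phi (Nz ^+ k) = N ^+ k.
Proof. by rewrite nilpS_int /phi rmorphXn. Qed.

Lemma nilpS_top_entry (i j : 'I_n.+1) :
  ((serre_mx n - 1) ^+ n) i j != 0 -> (N ^+ n) i j != 0.
Proof. by rewrite -base_change_nilpSX nilpS_int mxE intr_eq0. Qed.

Lemma nilpS_top_neq0 : N ^+ n != 0.
Proof.
have [i [j ij]] := serre_mx_top_entry n; apply/matrix0Pn.
by exists i, j; exact: nilpS_top_entry.
Qed.

Lemma base_change_adjoint g : phi (adjoint int n g) = adjoint F n (phi g).
Proof.
have phiG : phi (gramS int n) = gramS F n.
  by apply/matrixP => i j; rewrite !mxE intz.
have uG := gramS_unit int n.
rewrite /adjoint !base_changeM phiG /phi map_trmx.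
by rewrite [map_mx _ (gramS int n)^-1]rmorphV //= [map_mx _ _]phiG.
Qed.

Lemma IsomK0_base_change g : IsomK0 int n g -> IsomK0 F n (phi g).
Proof.
move=> /IsomK0P ig; apply/IsomK0P.
by rewrite -base_change_adjoint -base_changeM ig base_change1.
Qed.

Lemma IsomK0_lead (g : 'M[F]_n.+1) (k : nat) : IsomK0 F n g -> (k <= n)%N ->
  N ^+ (n.+1 - k) * (g - 1) = 0 ->
  exists a, N ^+ (n - k) * (g - 1) = a *: N ^+ n.
Proof.
move=> ig le_kn; have [i [j /nilpS_top_entry ij]] := serre_mx_top_entry n.
apply: (cyclic_nilp_lead _ _ _ _ _ (nilpS_nilp F n) ij) => //.
by apply/commr_sym/commrB; [exact/commr_sym/IsomK0_comm | exact: commr1].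
Qed.

Lemma IsomK0_commute (g h : 'M[F]_n.+1) :
  IsomK0 F n g -> IsomK0 F n h -> g * h = h * g.
Proof.
move=> ig ih; have [i [j /nilpS_top_entry ij]] := serre_mx_top_entry n.
by apply: (cyclic_nilp_comm _ _ _ _ _ (nilpS_nilp F n) ij); exact: IsomK0_comm.
Qed.

End BaseChange.

(** For k <= n + 1 this says that N^k divides g - 1 over Q, put so that it makes sense over the
    integers. Level 0 consists of all isometries, level 1 of the unipotent ones, and level n + 1 is
    trivial. *)
Definition isom_filtration (k : nat) : set 'M[int]_n.+1 :=
  [set g | IsomK0 int n g /\ Nz ^+ (n.+1 - k) * (g - 1) = 0].

Local Notation U := isom_filtration.
Local Notation phi := (base_change rat).
Local Notation N := (nilpS rat n).

Lemma isom_filtration_sub (k l : nat) : (k <= l)%N -> U l `<=` U k.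
Proof.
move=> le_kl g [ig gE]; split=> //.
have -> : (n.+1 - k = (n.+1 - k - (n.+1 - l)) + (n.+1 - l))%N.
  by rewrite subnK // leq_sub2l.
by rewrite exprD -mulrA gE mulr0.
Qed.

Lemma isom_filtration1 (k : nat) : U k 1.
Proof. by split; [exact: IsomK0_1 | rewrite subrr mulr0]. Qed.

Lemma isom_filtrationM (k : nat) g h : U k g -> U k h -> U k (g * h).
Proof.
move=> [ig gE] [ih hE]; split; first exact: IsomK0_mul.
have -> : g * h - 1 = (g - 1) * h + (h - 1).
  by rewrite mulrBl mul1r addrA subrK.
by rewrite mulrDr mulrA gE mul0r add0r.
Qed.

Lemma isom_filtrationV (k : nat) g : U k g -> U k g^-1.
Proof.
move=> [ig gE]; split; first exact: IsomK0_inv.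
have ug := IsomK0_unit _ _ _ ig.
have -> : g^-1 - 1 = - ((g - 1) * g^-1) by rewrite mulrBl mulrV // mul1r opprB.
by rewrite mulrN mulrA gE mul0r oppr0.
Qed.

Lemma isom_filtration_commute (k : nat) g h : U k g -> U k h -> g * h = h * g.
Proof.
move=> [ig _] [ih _]; apply: (base_change_inj rat); rewrite !base_changeM.
by apply: IsomK0_commute; exact: IsomK0_base_change.
Qed.

Lemma isom_filtration_lead (k : nat) g : (k <= n)%N -> U k g ->
  exists a, phi (Nz ^+ (n - k) * (g - 1)) = a *: N ^+ n.
Proof.
move=> le_kn [ig gE].
rewrite base_changeM base_change_nilpSX base_changeB base_change1.
apply: IsomK0_lead => //; first exact: IsomK0_base_change.
rewrite -base_change_nilpSX -(base_change1 rat) -base_changeB -base_changeM gE.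
exact: base_change0.
Qed.

(** In g h - 1 = (g - 1)(h - 1) + (g - 1) + (h - 1) the product has order at least 2 k > k, so
    N^(n-k) kills it. *)
Lemma isom_filtration_mul_lead (k : nat) g h : (0 < k <= n)%N -> U k g -> U k h ->
  Nz ^+ (n - k) * (g * h - 1) =
  Nz ^+ (n - k) * (g - 1) + Nz ^+ (n - k) * (h - 1).
Proof.
move=> /andP[k_gt0 le_kn] Ug Uh.
have -> : g * h - 1 = (g - 1) * (h - 1) + ((g - 1) + (h - 1)).
  by rewrite mulrBr mulr1 addrA subrK mulrBl mul1r addrA subrK.
rewrite (mulrDr _ ((g - 1) * _)) (mulrDr _ (g - 1)) -[RHS]add0r; congr (_ + _).
apply: (base_change_inj rat).
have [a aE] := isom_filtration_lead k g le_kn Ug.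
have [_ hE] := isom_filtration_sub _ _ k_gt0 _ Uh.
rewrite mulrA base_changeM aE -scalerAl -base_change_nilpSX -base_changeM.
by rewrite -[n in Nz ^+ n]subn0 -subSS hE base_change0 scaler0.
Qed.

(** The leading coefficient a satisfies 2 a = 0, hence vanishes over Q. Even levels can thus be
    skipped. *)
Lemma isom_filtration_even (k : nat) : ~~ odd k -> (0 < k)%N -> U k `<=` U k.+1.
Proof.
move=> even_k k_gt0 g Ug; have [ig gE] := Ug; split=> //; rewrite subSS.
have [le_kn|lt_nk] := leqP k n; last first.
  by move: gE; have -> : (n.+1 - k = n - k)%N by lia.
have [a aE] := isom_filtration_lead k g le_kn Ug.
have [_ g1] := isom_filtration_sub _ _ k_gt0 _ Ug.
apply: (base_change_inj rat); rewrite aE base_change0.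
have : (a *+ 2) *: N ^+ n = 0.
  apply: (IsomK0_even_lead _ _ (phi g) k) => //; first exact: IsomK0_base_change.
    move: g1; rewrite subSS subn0 => g1.
    rewrite -base_change_nilpSX -(base_change1 rat) -base_changeB -base_changeM.
    by rewrite g1 base_change0.
  by rewrite -aE base_changeM base_change_nilpSX base_changeB base_change1.
move/eqP; rewrite scaler_eq0 (negbTE (nilpS_top_neq0 rat)) orbF mulrn_eq0 /=.
by move/eqP->; rewrite scale0r.
Qed.

Lemma isom_filtration_free :
  exists f : 'rV[int]_(n.+1 %/ 2) -> 'M[int]_n.+1,
    (forall u v, f (u + v) = f u * f v) /\
    set_bij [set: 'rV[int]_(n.+1 %/ 2)] (U 1) f.
Proof.
have [i0 [j0 ij]] := serre_mx_top_entry n.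
(* Only odd levels are kept. The character is an entry of an integer matrix, equal to the rational
   leading coefficient times a fixed nonzero integer, the entry of N^n. *)
apply: (filtered_group_free _ _ (fun i => U i.*2.+1)
  (fun i g => (Nz ^+ (n - i.*2.+1) * (g - 1)) i0 j0)).
- by move=> i; exact: isom_filtration1.
- by move=> i g h; exact: isom_filtrationM.
- by move=> i g; exact: isom_filtrationV.
- by move=> i g [ig _]; exact: IsomK0_unit.
- by move=> i g h; exact: isom_filtration_commute.
- move=> i g h im Ug Uh; rewrite isom_filtration_mul_lead ?mxE //.
  by apply/andP; split=> //; lia.
- move=> i g im; rewrite doubleS; split=> [Ug|[Ug gE]].
    split; first exact: (isom_filtration_sub _ i.*2.+3 (leqW (leqnSn _)) _ Ug).
    have [_ gE] := isom_filtration_sub _ _ (leqnSn _) _ Ug.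
    by rewrite -subSS gE mxE.
  (* Vanishing of the character only has to reach level 2 i + 2; being even, this level equals level
     2 i + 3. *)
  apply: isom_filtration_even => //; first by rewrite /= odd_double.
  have le_kn : (i.*2.+1 <= n)%N by lia.
  have [a aE] := isom_filtration_lead _ _ le_kn Ug.
  split; first by case: Ug.
  rewrite subSS; apply: (base_change_inj rat); rewrite aE base_change0.
  have := congr1 (fun A : 'M[rat]_n.+1 => A i0 j0) aE.
  rewrite mxE gE [RHS]mxE => /esym/eqP; rewrite mulf_eq0.
  by rewrite (negbTE (nilpS_top_entry rat _ _ ij)) orbF => /eqP->; rewrite scale0r.
- move=> i im; have le_kn : (i.*2.+1 <= n)%N by lia.
  have [||g ig gE] := IsomK0_exists_lead int n i.*2.+1 => //.
    by rewrite /= odd_double.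
  exists g; first split=> //.
    by rewrite subSn // exprS -mulrA gE mulrnAr -exprS nilpS_nilp mul0rn.
  by rewrite gE mulmxnE mulrn_eq0 /= nilpS_int.
(* The last level is at least n + 1, so the exponent of N is 0 and g - 1 itself vanishes. *)
- move=> g [_]; have -> : (n.+1 - (n.+1 %/ 2).*2.+1 = 0)%N by lia.
  by rewrite mul1r => /eqP; rewrite subr_eq0 => /eqP.
Qed.

End IntegralIsometries.

(** * The identity component of the real isometry group *)

Section IdentityComponent.

Variables (R : realType) (n : nat).
Implicit Types g x : 'M[R]_n.+1.

Local Notation N := (nilpS R n).

Lemma poly_path_continuous (m : nat) (e : 'I_m -> nat) (A : 'I_m -> 'M[R]_n.+1) :
  continuous (fun t : R => \sum_(k < m) t ^+ e k *: A k).
Proof.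
apply: continuous_big => [|k _ t]; first exact: add_continuous.
by apply: cvgZr_tmp; exact: exprn_continuous.
Qed.

Lemma mulmx_entry_continuous (A : 'M[R]_n.+1) (i j : 'I_n.+1) :
  continuous (fun g => (A * g) i j).
Proof.
have -> : (fun g => (A * g) i j) = (fun g => \sum_k A i k * g k j).
  by apply/funext => g; rewrite mxE.
apply: continuous_big => [|k _ g]; first exact: add_continuous.
exact: (cvgMl_tmp (@coord_continuous R n.+1 n.+1 k j g)).
Qed.

(* On isometries, g |-> (N ^ n g) i j takes only the two values
   +- (N ^ n) i j, hence it is constant on the identity component. *)
Lemma IsomK0R_e_top g : IsomK0R_e R n g -> N ^+ n * (g - 1) = 0.
Proof.
move=> Cg; have [i [j /(nilpS_top_entry _ R) ij]] := serre_mx_top_entry n.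
have lead h : IsomK0 R n h ->
    exists2 a, N ^+ n * h = a *: N ^+ n & a = 1 \/ a = -1.
  move=> ih; have [a aE] : exists a, N ^+ n * h = a *: N ^+ n.
    have [|a] := cyclic_nilp_lead _ _ _ _ _ (nilpS_nilp R n) ij h 0
      (IsomK0_comm _ _ _ ih) (leq0n _).
      by rewrite subn0 nilpS_nilp mul0r.
    by rewrite subn0; exists a.
  exists a => //; have := IsomK0_lead0 _ _ _ _ ih aE.
  move/matrixP/(_ i j)/eqP; rewrite mxE -[X in _ == X]mul1r (inj_eq (mulIf ij)).
  by rewrite sqrf_eq1 => /orP[] /eqP; [left | right].
have C1 : IsomK0R_e R n 1 by apply: connected_component_refl; exact: IsomK0_1.
pose f h := (N ^+ n * h) i j.
(* The image is an interval containing f 1. If g had constant term -1, it would also contain the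
   opposite value, hence 0, which f takes at no isometry. *)
have : is_interval (f @` IsomK0R_e R n).
  apply/connected_intervalP; apply: connected_continuous_connected.
    exact: component_connected.
  exact/continuous_subspaceT/mulmx_entry_continuous.
have f1 : (f @` IsomK0R_e R n) (f 1) by exists 1.
have fg : (f @` IsomK0R_e R n) (f g) by exists g.
have [a aE] := lead g (connected_component_sub Cg).
case=> a1; first by rewrite mulrBr aE a1 scale1r mulr1 subrr.
have f1E : f 1 = (N ^+ n) i j by rewrite /f mulr1.
have fgE : f g = - (N ^+ n) i j by rewrite /f aE a1 scaleN1r mxE.
have f0 : ~ (f @` IsomK0R_e R n) 0.
  move=> [h /connected_component_sub/lead[b bE b1]].
  rewrite /f bE mxE => /eqP; rewrite mulf_eq0 (negbTE ij) orbF => /eqP b0.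
  by case: b1 => /eqP; rewrite b0 ?eqr_oppLR ?oppr0 eq_sym ?oppr_eq0 oner_eq0.
move=> itv; exfalso; apply: f0.
have [c0|c0] := leP 0 ((N ^+ n) i j).
  by apply: (itv _ _ fg f1); rewrite fgE f1E oppr_le0 c0.
by apply: (itv _ _ f1 fg); rewrite fgE f1E oppr_ge0 (ltW c0).
Qed.

(* A unipotent isometry g is joined to 1 by the Cayley transforms
   (1 + t x) (1 - t x)^-1, where x = (g - 1) (g + 1)^-1 is skew-adjoint. *)
Lemma IsomK0R_e_unipotent g : IsomK0 R n g -> N ^+ n * (g - 1) = 0 ->
  IsomK0R_e R n g.
Proof.
move=> ig gE; have ug := IsomK0_unit _ _ _ ig.
have [i [j /(nilpS_top_entry _ R) ij]] := serre_mx_top_entry n.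
have gN := IsomK0_comm _ _ _ ig.
have nil_g : (g - 1) ^+ n.+1 = 0.
  have [||z zN ->] := cyclic_nilp_factor _ _ _ _ _ (nilpS_nilp R n) ij
    (g - 1) 1 _ isT.
  - by apply/commr_sym/commrB; [exact/commr_sym | exact: commr1].
  - by rewrite subSS subn0.
  rewrite expr1 exprMn_comm ?nilpS_nilp ?mul0r //; exact: commr_sym.
have uh : g + 1 \is a GRing.unit.
  have -> : g + 1 = 2 *: (1 - (- 2^-1) *: (g - 1)).
    rewrite scaleNr opprK scalerDr scalerA divff ?pnatr_eq0 // scale1r.
    by rewrite scaler_nat mulr2n -addrA [1 + (g - 1)]addrC subrK addrC.
  rewrite [_ \is a _]unitmxZ ?unitfE ?pnatr_eq0 //.
  by apply: (unit_sub_nilp _ _ _ n.+1); rewrite exprZn nil_g scaler0.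
have gh : GRing.comm g (g + 1)^-1.
  by apply/commrV/commrD; [exact: commr_refl | exact: commr1].
pose x := (g - 1) * (g + 1)^-1.
have xh : x * (g + 1) = g - 1 by rewrite /x mulrVK.
have gx : g * x = x * g.
  rewrite /x mulrA -[RHS]mulrA -gh mulrA; congr (_ * _).
  by rewrite mulrBr mulrBl mulr1 mul1r.
have xgx : x + x * g = x * (g + 1) by rewrite mulrDr mulr1 addrC.
have adjx : adjoint R n x = - x.
  have E : adjoint R n x = (g^-1 + 1)^-1 * (g^-1 - 1).
    rewrite /x adjointM adjointV // adjointB adjointD adjoint1.
    by rewrite IsomK0_adjoint.
  have uh' : g^-1 + 1 \is a GRing.unit.
    have -> : g^-1 + 1 = g^-1 * (g + 1) by rewrite mulrDr mulVr // mulr1 addrC.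
    by rewrite unitrMl // unitrV.
  apply: (mulrI uh'); rewrite E mulVKr // mulrN mulrDl mul1r.
  apply: (mulrI ug); rewrite mulrBr mulrN mulrDr mulVKr // mulrV // mulr1 gx.
  by rewrite xgx xh opprB.
have nil_x : x ^+ n.+1 = 0.
  rewrite /x exprMn_comm ?nil_g ?mul0r //.
  by apply/commr_sym/commrB; [exact: commr_sym | exact: commr1].
have nil_tx t : (t *: x) ^+ n.+1 = 0 by rewrite exprZn nil_x scaler0.
have um t : 1 - t *: x \is a GRing.unit by exact: unit_sub_nilp (nil_tx t).
(* The finite geometric series for (1 - t x)^-1 makes the Cayley path polynomial in t, so its
   continuity is immediate. *)
pose path t := \sum_(k < n.+1) t ^+ k *: x ^+ k
             + \sum_(k < n.+1) t ^+ k.+1 *: x ^+ k.+1.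
have pathE t : path t = (1 + t *: x) * (1 - t *: x)^-1.
  have VE : (1 - t *: x)^-1 = \sum_(k < n.+1) (t *: x) ^+ k.
    apply: (mulrI (um t)); rewrite mulrV // -opprB mulNr -subrX1 nil_tx.
    by rewrite sub0r opprK.
  rewrite VE mulrDl mul1r mulr_sumr; congr (_ + _); apply: eq_bigr => k _.
    by rewrite exprZn.
  by rewrite -exprS exprZn.
have path_isom t : IsomK0 R n (path t).
  apply/IsomK0P; rewrite pathE adjointM adjointV // adjointB adjointD adjointZ.
  rewrite adjoint1 adjx scalerN opprK.
  have up : 1 + t *: x \is a GRing.unit.
    by rewrite -[t *: x]opprK -scaleNr; exact: um.
  have pm : GRing.comm (1 + t *: x) (1 - t *: x).
    apply/commrB; first exact: commr1.
    by apply/commr_sym/commrD; [exact: commr1 | exact: commr_refl].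
  by rewrite mulrA -(mulrA _ (1 - _)) -pm mulKr // mulrV.
have path_cont : continuous path.
  by move=> t; apply: cvgD; exact: poly_path_continuous.
have conn : connected (path @` `[0, 1]%classic).
  apply: connected_continuous_connected; first exact: segment_connected.
  exact: continuous_subspaceT.
apply: (connected_component_max _ _ conn).
- exists 0; first by rewrite /= in_itv /= lexx ler01.
  by rewrite pathE scale0r addr0 subr0 divr1.
- by move=> _ [t _ <-]; exact: path_isom.
(* At t = 1 the path reaches g, because g (1 - x) = 1 + x. *)
- exists 1; first by rewrite /= in_itv /= lexx ler01.
  rewrite pathE scale1r; have := um 1; rewrite scale1r => u1.
  apply: (mulIr u1); rewrite mulrVK // mulrBr mulr1 gx.
  by apply/eqP; rewrite eq_sym subr_eq -addrA xgx xh addrC subrK.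
Qed.

(** Over the reals the component is cut out by N^n (g - 1) = 0, and this equation descends to the
    integers because base change is injective. *)
Lemma IsomK0_eE : IsomK0_e R n = isom_filtration n 1.
Proof.
have topE (g : 'M[int]_n.+1) :
    N ^+ n * (map_mx intr g - 1) = map_mx intr (nilpS int n ^+ n * (g - 1)).
  rewrite -[RHS]/(base_change n R _) base_changeM base_changeB.
  by rewrite base_change_nilpSX base_change1.
apply/seteqP; split=> g [ig gE]; split=> //.
  apply: (base_change_inj n R); rewrite base_change0 subSS subn0.
  by rewrite -[LHS]topE; exact: IsomK0R_e_top.
apply: IsomK0R_e_unipotent; first exact: IsomK0_base_change.
by rewrite topE; move: gE; rewrite subSS subn0 => ->; rewrite map_mx0.
Qed.

End IdentityComponent.

Theorem proposition5 (R : realType) (n : nat) (hn : (1 <= n)%N) :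
  exists f : 'rV[int]_(n.+1 %/ 2) -> 'M[int]_n.+1,
    (forall u v, f (u + v) = f u *m f v) /\
    set_bij [set: 'rV[int]_(n.+1 %/ 2)] (IsomK0_e R n) f.
Proof. by rewrite IsomK0_eE; exact: isom_filtration_free. Qed.
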